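(* Let $T$ be a homogeneous tree of homogeneity degree $q$ with reference vertex $v_0$ and reference edge $e_0$. If $\mathcal F^{\mathbb Z}$ is the Laplace transform on $\mathbb Z$, i.e. the complex Fourier series operator, then $$\mathcal G^V_{v_0}=\mathcal F^{\mathbb Z}\,\mathcal R_V,\qquad \mathcal G^E_{e_0}=\mathcal F^{\mathbb Z}\,\mathcal R_E,$$ in the sense that, for $f$ on $V$ such that the series $\mathcal G^V_{v_0}f$ converges, $\mathcal G^V_{v_0}f(z,\omega)=\mathcal F^{\mathbb Z}(\{g_n(\omega)\})(z)$ with $g_n(\omega)=\mathcal R_Vf(\omega,n)$, that is $$\mathcal G^V_{v_0}f(z,\omega)=\sum_{n\in\mathbb Z}\mathcal R_Vf(\omega,n)\,q^{nz},$$ with respect to the choice of the reference vertex $v_0$. In more intrinsic notation, that does not require a choice of reference, this becomes $$\mathcal G^V_{v_0}f(z,\mathbf h)=\bigl(\mathcal F^{\mathbb Z}_n[\mathcal R_Vf(n+\mathbf h)]\bigr)(z)$$ for vertex-horospheres $\mathbf h$, where $\mathcal F^{\mathbb Z}_n$ is $\mathcal F^{\mathbb Z}$ acting on the variable $n$. The formula for $\mathcal G^E$ is analogous.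
   Context: $T$ is a tree in which every vertex has exactly $q+1$ neighbours, with vertex set $V$, unoriented edge set $E$, graph distance $\operatorname{dist}$. $\Omega$ is the set of ends (equivalence classes of geodesic rays that eventually coincide). Indices: $h(v,v_0,\omega)=\operatorname{dist}(v_0,w)-\operatorname{dist}(v,w)$ for any $w$ far enough along the ray from $v_0$ to $\omega$; $h(e,e_0,\omega)=h(v(e,\omega),v(e_0,\omega),\omega)$, with $v(e,\omega)$ the endpoint of $e$ closer to $\omega$. The vertex- (edge-) horospheres tangent at $\omega$ are the level sets of the index for fixed $\omega$; if $\mathbf h$ is a horosphere tangent at $\omega$ and $n\in\mathbb Z$, then $n+\mathbf h$ is the horosphere tangent at $\omega$ whose index is that of $\mathbf h$ increased by $n$. Radon transforms: $\mathcal R_Vf(\mathbf h)=\sum_{v\in\mathbf h}f(v)$, i.e. $\mathcal R_Vf(\omega,n)=\sum_{v:h(v,v_0,\omega)=n}f(v)$, and $\mathcal R_Ef(\mathbf h)=\sum_{e\in\mathbf h}f(e)$, i.e. $\mathcal R_Ef(\omega,n)=\sum_{e:h(e,e_0,\omega)=n}f(e)$. Spherical Fourier transforms, for $z\in\mathbb C$: $\mathcal G^V_{v_0}f(z,\omega)=\sum_{v\in V}f(v)\,q^{z\,h(v,v_0,\omega)}$, $\mathcal G^E_{e_0}f(z,\omega)=\sum_{e\in E}f(e)\,q^{z\,h(e,e_0,\omega)}$; as functions of a horosphere $\mathbf h$ they are given by the pairing $\langle\mathcal R f(n+\mathbf h),\overline{\sigma}(n)\rangle_{\ell^2(\mathbb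 Z)}$ in the variable $n$, where $\sigma(n)=q^{zn}$ and $\mathcal R$ is $\mathcal R_V$ or $\mathcal R_E$. For a sequence $g=(g_n)_{n\in\mathbb Z}$, $\mathcal F^{\mathbb Z}g(z)=\sum_{n}g_nq^{nz}$ is its complexified Fourier series. *)

(* Defs.v *)
From HB Require Import structures.
From mathcomp Require Import all_boot all_order all_algebra finmap complex.
From mathcomp Require Import all_classical all_reals topology normedtype.
From mathcomp Require Import sequences exp trigo.
From mathcomp Require Import showcase.summability.

Set Implicit Arguments.
Unset Strict Implicit.
Unset Printing Implicit Defensive.

Import Order.TTheory GRing.Theory Num.Theory.
Import numFieldNormedType.Exports.

Local Open Scope classical_set_scope.
Local Open Scope ring_scope.
Local Open Scope complex_scope.

Section Series.
Context {R : realType}.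

(* Series indexed by a set without a preferred enumeration: limits along the
   directed set of finite subsets, which for complex terms amounts to absolute
   convergence. The alias R[i]^o carries the normed space structure. *)
Definition converges {I : choiceType} (f : I -> R[i]) : Prop :=
  cvg (partial_sum (f : I -> R[i]^o) @ totally).

Definition usum {I : choiceType} (f : I -> R[i]) : R[i] :=
  sum (f : I -> R[i]^o).

Definition zero_outside {I : choiceType} (A : set I) (f : I -> R[i]) :
  I -> R[i] := patch (fun=> 0) A f.

Definition cexp (w : R[i]) : R[i] :=
  (expR (complex.Re w))%:C * (cos (complex.Im w) +i* sin (complex.Im w)).

Definition cpow (q : nat) (w : R[i]) : R[i] := cexp (w * (ln (q%:R : R))%:C).

Definition laplace_term (q : nat) (g : int -> R[i]) (z : R[i]) (n : int) :
  R[i] := g n * cpow q (n%:~R * z).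

Definition laplace (q : nat) (g : int -> R[i]) (z : R[i]) : R[i] :=
  usum (laplace_term q g z).

(* The l^2(Z) inner product, conjugate-linear in the second argument, read as a
   formal pairing: neither argument is required to be square-summable. *)
Definition pairing (a b : int -> R[i]) : R[i] :=
  usum (fun n => a n * (b n)^*).

End Series.

Record homogeneous_tree (q : nat) := HomogeneousTree {
  vertex :> choiceType;
  adj : rel vertex;
  _ : symmetric adj;
  _ : irreflexive adj;
  _ : forall u v, exists2 p, path adj u p & last u p = v;
  _ : forall c, (2 < size c)%N -> ~ ucycle adj c;
  _ : forall u, ([set v | adj u v] #= `I_q.+1)%card }.

Section Tree.
Context {q : nat} (T : homogeneous_tree q).

Definition edge : choiceType :=
  {e : {fset T} | `[< exists u v, adj u v /\ e = [fset u; v]%fset >]}.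

Definition walk_length (u v : T) : set nat :=
  [set n | exists p, [/\ path (@adj q T) u p, last u p = v & size p = n]].

Definition dist (u v : T) : nat :=
  xget 0%N [set n | walk_length u v n /\
                    forall m, walk_length u v m -> (n <= m)%N].

Definition geodesic_ray (r : nat -> T) : Prop :=
  forall m n, (m <= n)%N -> dist (r m) (r n) = (n - m)%N.

Definition cofinal (r s : nat -> T) : Prop :=
  exists m n, forall k, r (m + k)%N = s (n + k)%N.

Record tree_end := TreeEnd {
  rays : set (nat -> T);
  _ : exists2 r, geodesic_ray r & rays = [set s | geodesic_ray s /\ cofinal r s] }.

Definition vindex (v v0 : T) (w : tree_end) : int :=
  xget 0 [set k | exists2 r, rays w r /\ r 0%N = v0 &
    \forall n \near \oo, (dist v0 (r n))%:Z - (dist v (r n))%:Z = k].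

Definition closer_endpoint (e : edge) (w : tree_end) : set T :=
  [set x | x \in val e /\ exists2 r, rays w r &
    \forall n \near \oo, forall y, y \in val e -> y != x ->
      (dist x (r n) < dist y (r n))%N].

(* Exactly one endpoint of e is closer to w, so k is uniquely determined. *)
Definition eindex (e e0 : edge) (w : tree_end) : int :=
  xget 0 [set k | exists x x0, [/\ closer_endpoint e w x,
    closer_endpoint e0 w x0 & k = vindex x x0 w]].

End Tree.

(* Horospheres and transforms attached to an index function idx x x0 w on X;
   used with X the vertices and with X the edges of a tree, and with W the ends. *)
Section Transforms.
Context {R : realType} {W : Type} {X : choiceType} (idx : X -> X -> W -> int).

Definition level (x0 : X) (w : W) (n : int) : set X := [set x | idx x x0 w = n].

Definition horosphere (w : W) (h : set X) : Prop :=
  exists x0 n, h = level x0 w n.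

(* n + h: if h has index m with respect to the reference x0, then n + h has
   index n + m; the cocycle relation of the index makes this independent of x0. *)
Definition hshift (w : W) (n : int) (h : set X) : set X :=
  [set x | exists x0 m, h = level x0 w m /\ idx x x0 w = n + m].

Definition radon_converges (f : X -> R[i]) (h : set X) : Prop :=
  converges (zero_outside h f).

Definition radon (f : X -> R[i]) (h : set X) : R[i] :=
  usum (zero_outside h f).

Definition fourier_term (q : nat) (x0 : X) (f : X -> R[i]) (z : R[i]) (w : W)
  (x : X) : R[i] := f x * cpow q (z * (idx x x0 w)%:~R).

Definition fourier (q : nat) (x0 : X) (f : X -> R[i]) (z : R[i]) (w : W) :
  R[i] := usum (fourier_term q x0 f z w).

Definition fourier_horo (q : nat) (f : X -> R[i]) (z : R[i]) (w : W)
  (h : set X) : R[i] :=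
  pairing (fun n => radon f (hshift w n h))
          (fun n => (cpow q (z * n%:~R))^*).

End Transforms.

(* Main.v *)
Require Import Defs.
From HB Require Import structures.
From mathcomp Require Import all_boot all_order all_algebra finmap complex.
From mathcomp Require Import all_classical all_reals topology normedtype.
From mathcomp Require Import sequences exp trigo.
From mathcomp Require Import showcase.summability.
From mathcomp Require Import zify ring.

(** Grouping the terms of an unordered convergent series by the fibres of the
    index gives the slice formula; convergence of the grouped series comes from
    the Cauchy criterion. For horospheres, the cocycle relation of the index
    identifies [n + h] with the level [n] of the index based at any [y] in [h],
    and changing the base multiplies the Fourier terms by a constant. This needs
    horospheres to be nonempty, which is where the tree enters. For a ray [r] of
    the end, [dist v (r n) - n] is eventually constant, equal to the Busemann
    function of [v], and the vertex index is a difference of its values. Since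
    there are no cycles, it changes by exactly one along each edge and a vertex
    has at most one neighbour where it is smaller; as the degree is at least two,
    it takes every integer value, also on the closer endpoints of edges. *)

Set Implicit Arguments.
Unset Strict Implicit.
Unset Printing Implicit Defensive.

Import Order.TTheory GRing.Theory Num.Theory.
Import numFieldNormedType.Exports.

Local Open Scope classical_set_scope.
Local Open Scope ring_scope.
Local Open Scope complex_scope.

#[local] Existing Instance totally_filter.

(** * Unordered sums of complex families *)

Section UnorderedSums.
Context {R : realType}.
Implicit Types I : choiceType.

Definition fsum {I} (f : I -> R[i]) (J : {fset I}) : R[i] := \sum_(i <- J) f i.

(** Convergence along finite subsets in epsilon form. The tolerance lives in [R[i]], like the norm;
    [0 < eps] forces it to be real. *)
Definition has_sum {I} (f : I -> R[i]) (l : R[i]) : Prop :=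
  forall eps : R[i], 0 < eps ->
    exists J, forall K, (J `<=` K)%fset -> `|l - fsum f K| < eps.

Lemma partial_sumE {I} (f : I -> R[i]) (J : {fset I}) :
  partial_sum (f : I -> R[i]^o) J = fsum f J.
Proof. by rewrite /fsum big_seq_fsetE. Qed.

Lemma has_sumP {I} (f : I -> R[i]) (l : R[i]) :
  has_sum f l <-> partial_sum (f : I -> R[i]^o) @ totally --> (l : R[i]^o).
Proof.
split=> [fl|/cvgrPdist_lt fl eps /fl[J _ JP]].
  apply/cvgrPdist_lt => eps /fl[J JP]; exists J => // K /= /JP.
  by rewrite -partial_sumE.
by exists J => K /JP; rewrite -partial_sumE.
Qed.

Lemma has_sum_converges {I} (f : I -> R[i]) (l : R[i]) :
  has_sum f l -> converges f.
Proof. by move=> /has_sumP/cvgP. Qed.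

Lemma has_sum_usum {I} (f : I -> R[i]) (l : R[i]) : has_sum f l -> usum f = l.
Proof. by move=> /has_sumP fl; exact: (@cvg_lim R[i]^o). Qed.

Lemma convergesP {I} (f : I -> R[i]) : converges f -> has_sum f (usum f).
Proof. by move=> cf; apply/has_sumP. Qed.

Lemma has_sum0 {I} : has_sum (fun _ : I => 0) 0.
Proof.
by move=> e e0; exists fset0 => K _; rewrite /fsum big1 // subrr normr0.
Qed.

Lemma has_sumD {I} (f g : I -> R[i]) (k l : R[i]) :
  has_sum f k -> has_sum g l -> has_sum (fun i => f i + g i) (k + l).
Proof.
move=> fk gl e e0; have e20 : 0 < e / 2 by rewrite divr_gt0.
have [J JP] := fk _ e20; have [J' JP'] := gl _ e20.
exists (J `|` J')%fset => K; rewrite fsubUset => /andP[/JP Kk /JP' Kl].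
rewrite /fsum big_split/= opprD addrACA (splitr e).
by apply: (le_lt_trans (ler_normD _ _)); exact: ltrD.
Qed.

Lemma has_sumZ {I} (c : R[i]) (f : I -> R[i]) (l : R[i]) :
  has_sum f l -> has_sum (fun i => f i * c) (l * c).
Proof.
have [->|c0] := eqVneq c 0.
  move=> _; rewrite mulr0; under eq_fun do rewrite mulr0; exact: has_sum0.
move=> fl e e0; have nc0 : 0 < `|c| by rewrite normr_gt0.
have [J JP] := fl (e / `|c|) (divr_gt0 e0 nc0).
exists J => K /JP Kl; rewrite /fsum -mulr_suml -mulrBl normrM.
by rewrite -ltr_pdivlMr.
Qed.

Lemma real_net_cvg {I} (h : {fset I} -> R) :
  (forall eps : R, 0 < eps -> exists J, forall K, (J `<=` K)%fset ->
     `|h J - h K| < eps) ->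
  exists l : R, forall eps : R, 0 < eps -> exists J, forall K,
    (J `<=` K)%fset -> `|l - h K| < eps.
Proof.
move=> hC; have /cvg_ex[l /cvgrPdist_lt hl] : cvg (h @ (@totally I)).
  apply: cauchy_cvg; apply: cauchy_exP => e /hC[J JP].
  by exists (h J); exists J => // K /= /JP; rewrite -ball_normE.
by exists l => e /hl[J _ JP]; exists J => K /JP.
Qed.

Lemma normc_ge_Im (x : R[i]) : `|complex.Im x|%:C <= `|x|.
Proof.
have := normc_ge_Re (x * 'i).
rewrite normrM (_ : `|'i| = 1) ?mulr1; last first.
  by rewrite normc_def /= expr0n expr1n add0r sqrtr1.
by case: x => a b /=; rewrite mulr0 mulr1 sub0r normrN.
Qed.

Lemma normc_le_ReD (x : R[i]) : `|x| <= (`|complex.Re x| + `|complex.Im x|)%:C.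
Proof.
case: x => a b /=; rewrite (_ : a +i* b = a%:C + b%:C * 'i); last first.
  by apply/eqP; rewrite eq_complex /=; apply/andP; split; apply/eqP; ring.
apply: (le_trans (ler_normD _ _)); rewrite normrM !normc_def /=.
rewrite !expr0n /= !addr0 !sqrtr_sqr expr1n add0r sqrtr1 mulr1.
by rewrite rmorphD.
Qed.

Lemma gt0c (e : R[i]) : 0 < e -> 0 < complex.Re e /\ e = (complex.Re e)%:C.
Proof. by case: e => a b; rewrite ltcE /= => /andP[/eqP-> ->]. Qed.

(** Completeness of [R] is applied to the real and imaginary parts, each dominated by the modulus;
    conversely the modulus is at most the sum of their absolute values. *)
Lemma has_sum_cauchy {I} (f : I -> R[i]) :
  (forall eps : R[i], 0 < eps -> exists J, forall K, (J `<=` K)%fset ->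
     `|fsum f J - fsum f K| < eps) -> exists l, has_sum f l.
Proof.
move=> fC.
have [|a aP] := @real_net_cvg I (fun K => complex.Re (fsum f K)).
  move=> e e0; have [|J JP] := fC e%:C; first by rewrite ltcR.
  exists J => K /JP; rewrite -[_ < e]ltcR -raddfB; apply: le_lt_trans.
  exact: normc_ge_Re.
have [|b bP] := @real_net_cvg I (fun K => complex.Im (fsum f K)).
  move=> e e0; have [|J JP] := fC e%:C; first by rewrite ltcR.
  exists J => K /JP; rewrite -[_ < e]ltcR -raddfB; apply: le_lt_trans.
  exact: normc_ge_Im.
exists (a +i* b) => e /gt0c[e0 ->].
have e20 : 0 < complex.Re e / 2 by rewrite divr_gt0.
have [J JP] := aP _ e20; have [J' JP'] := bP _ e20.
exists (J `|` J')%fset => K; rewrite fsubUset => /andP[/JP Ka /JP' Kb].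
apply: le_lt_trans (normc_le_ReD _) _; rewrite ltcR !raddfB/=.
by rewrite (splitr (complex.Re e)) ltrD.
Qed.

Lemma fsum_zero_outside {I} (f : I -> R[i]) (A : set I) (K : {fset I}) :
  fsum (zero_outside A f) K = fsum f [fset i in K | i \in A]%fset.
Proof. by rewrite /fsum -big_fset_condE [RHS]big_mkcond. Qed.

(** Enlarging [J] by only those elements of [K] that lie in [A] changes the sum of [f] exactly as
    passing from [J] to [K] changes the restricted sum, so the Cauchy criterion carries over. *)
Lemma has_sum_zero_outside {I} (f : I -> R[i]) (l : R[i]) (A : set I) :
  has_sum f l -> exists k, has_sum (zero_outside A f) k.
Proof.
move=> fl; apply: has_sum_cauchy => e e0.
have e20 : 0 < e / 2 by rewrite divr_gt0.
have [J JP] := fl _ e20; exists J => K JK.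
pose L := (J `|` [fset i in K | i \in A])%fset.
have {}JP K' : (J `<=` K')%fset -> `|fsum f J - fsum f K'| < e.
  move=> JK'; rewrite -(subrKA l) (splitr e).
  apply: (le_lt_trans (ler_normD _ _)); apply: ltrD; last exact: JP.
  by rewrite distrC JP.
suff -> : fsum (zero_outside A f) J - fsum (zero_outside A f) K =
          fsum f J - fsum f L by apply: JP; exact: fsubsetUl.
rewrite !fsum_zero_outside.
set JA := [fset i in J | i \in A]%fset; set KA := [fset i in K | i \in A]%fset.
have JAKA : (JA `<=` KA)%fset.
  by apply/fsubsetP => i; rewrite !inE /= => /andP[/(fsubsetP JK) -> ->].
have fsD (B C : {fset I}) : (B `<=` C)%fset ->
    fsum f C = fsum f B + fsum f (C `\` B)%fset.
  move=> BC; rewrite /fsum (big_fsetID _ (mem B)) /=; congr (_ + _).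
    by apply: eq_fbigl => i; rewrite !inE /=; case: (boolP (i \in B)) => iB;
       rewrite ?andbF ?andbT ?(fsubsetP BC).
  by apply: eq_fbigl => i; rewrite !inE /= andbC.
rewrite (fsD _ _ JAKA) (fsD J L) ?fsubsetUl// !opprD !addrA !subrr.
congr (_ - fsum f _); apply/fsetP => i; rewrite !inE /=.
by case: (i \in J) => //=; case: (i \in A); rewrite ?andbF.
Qed.

Lemma in_set_pred {I} (P : pred I) (i : I) : (i \in [set j | P j]) = P i.
Proof. by apply/idP/idP; rewrite inE. Qed.

Lemma in_set_fiber {I J : choiceType} (p : I -> J) (n : J) (i : I) :
  (i \in [set j | p j = n]) = (p i == n).
Proof. by apply/idP/eqP; rewrite inE. Qed.

Lemma has_sum_fibers {I J : choiceType} (p : I -> J) (f : I -> R[i])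
    (g : J -> R[i]) (l : R[i]) :
  has_sum f l ->
  (forall n, has_sum (zero_outside [set i | p i = n] f) (g n)) -> has_sum g l.
Proof.
move=> fl fg.
(* Finite additivity: over finitely many fibres, the sum of [f] is the sum of the corresponding
   values of [g]. *)
have fgN (s : seq J) : uniq s ->
    has_sum (zero_outside [set i | p i \in s] f) (\sum_(n <- s) g n).
  elim: s => [_|n s IH /= /andP[ns us]].
    rewrite big_nil (_ : zero_outside _ _ = fun=> 0); first exact: has_sum0.
    by apply/funext => i; rewrite /zero_outside /patch memNset.
  rewrite big_cons; have := has_sumD (fg n) (IH us); congr has_sum.
  apply/funext => i; rewrite /zero_outside /patch !in_set_pred in_set_fiber inE.
  by case: eqVneq => [->|_]; rewrite ?(negbTE ns) ?addr0 ?add0r.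
move=> e e0; have e20 : 0 < e / 2 by rewrite divr_gt0.
have [J0 J0P] := fl _ e20; exists (p @` J0)%fset => N J0N.
have [J1 J1P] := fgN N (fset_uniq N) _ e20.
have /J1P := fsubsetUr J0 J1; rewrite fsum_zero_outside => J1N.
(* The intermediate term sums [f] over the part of [J0] and [J1] lying above [N]. It is near [l]
   because this part still contains [J0], and near the sum of [g] over [N] by the choice of [J1]. *)
rewrite -(subrKA
  (fsum f [fset i in J0 `|` J1 | i \in [set i | p i \in N]]%fset)).
rewrite (splitr e); apply: (le_lt_trans (ler_normD _ _)); apply: ltrD.
  apply: J0P; apply/fsubsetP => i iJ0; rewrite !inE /= iJ0 /= in_set_pred.
  by apply: (fsubsetP J0N); exact: in_imfset.
by rewrite distrC.
Qed.

End UnorderedSums.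

(** * Complex powers of [q] *)

Section ComplexPowers.
Context {R : realType}.

(* [pairing] conjugates with [Num.conj], [fourier_horo] with [conjc]. *)
Lemma conj_conjcK (a : R[i]) : Num.conj (conjc a) = a.
Proof. by rewrite (erefl : Num.conj (conjc a) = conjc (conjc a)) conjcK. Qed.

Lemma cexp0 : cexp 0 = 1 :> R[i].
Proof. by rewrite /cexp /= expR0 cos0 sin0 mul1r. Qed.

Lemma cexpD (a b : R[i]) : cexp (a + b) = cexp a * cexp b.
Proof.
case: a b => [a a'] [b b']; rewrite /cexp /= expRD cosD sinD.
by apply/eqP; rewrite eq_complex /=; apply/andP; split; apply/eqP; ring.
Qed.

Lemma cpowD (q : nat) (a b : R[i]) : cpow q (a + b) = cpow q a * cpow q b.
Proof. by rewrite /cpow mulrDl cexpD. Qed.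

Lemma cpow_neq0 (q : nat) (a : R[i]) : cpow q a != 0.
Proof.
have : cpow q a * cpow q (- a) != 0.
  by rewrite -cpowD subrr /cpow mul0r cexp0 oner_neq0.
by rewrite mulf_eq0 negb_or => /andP[].
Qed.

End ComplexPowers.

(** * Fourier slices and change of base for an abstract index *)

Section CocycleIndex.
Context {R : realType} {W : Type} {X : choiceType} (idx : X -> X -> W -> int).

(** On a level the index is constant, so the power of [q] comes out as a factor. *)
Lemma zero_outside_fourier_term q x0 (f : X -> R[i]) z w n :
  zero_outside (level idx x0 w n) (fourier_term idx q x0 f z w) =
  (fun x => zero_outside (level idx x0 w n) f x * cpow q (z * n%:~R)).
Proof.
apply/funext => x; rewrite /zero_outside /patch /level in_set_fiber.
by case: eqP => [<-|_]; rewrite ?mul0r.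
Qed.

Lemma fourier_slice q x0 (f : X -> R[i]) z w :
  converges (fourier_term idx q x0 f z w) ->
  [/\ forall n, radon_converges f (level idx x0 w n),
      converges (laplace_term q (fun n => radon f (level idx x0 w n)) z) &
      fourier idx q x0 f z w =
        laplace q (fun n => radon f (level idx x0 w n)) z].
Proof.
move=> /convergesP fS.
have radonS n : has_sum (zero_outside (level idx x0 w n) f)
    (radon f (level idx x0 w n)).
  have [k] := has_sum_zero_outside (level idx x0 w n) fS.
  (* Dividing by this nonzero power recovers the convergence of [f] itself on the level. *)
  rewrite zero_outside_fourier_term => /(has_sumZ (cpow q (z * n%:~R))^-1).
  under eq_fun do rewrite mulfK ?cpow_neq0 //.
  by move/has_sum_converges/convergesP.
have laplaceS : has_sum (laplace_term q (fun n => radon f (level idx x0 w n)) z)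
    (fourier idx q x0 f z w).
  apply: (has_sum_fibers fS (p := fun x => idx x x0 w)) => n.
  have := has_sumZ (cpow q (z * n%:~R)) (radonS n).
  by rewrite -zero_outside_fourier_term /laplace_term [n%:~R * z]mulrC.
split=> [n||]; [exact: has_sum_converges|exact: has_sum_converges laplaceS|].
by rewrite /laplace (has_sum_usum laplaceS).
Qed.

Lemma fourier_horoE q (f : X -> R[i]) z w h :
  fourier_horo idx q f z w h =
  laplace q (fun n => radon f (hshift idx w n h)) z.
Proof.
rewrite /fourier_horo /pairing /laplace; congr usum; apply/funext => n.
by rewrite /laplace_term conj_conjcK [z * _]mulrC.
Qed.

Variable w : W.
Hypothesis idxD : forall x y t, idx x t w = idx x y w + idx y t w.

(** Expanding the index of [x] through [y] makes the index of [y] relative to the old reference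
    cancel. *)
Lemma hshift_level h y n :
  horosphere idx w h -> h y -> hshift idx w n h = level idx y w n.
Proof.
move=> [x0 [m hE]] hy; apply/seteqP; split=> x /=.
  move=> [x1 [k [hE1 xk]]]; move: hy; rewrite hE1 /level /= => yk.
  by move: xk; rewrite (idxD x y) yk => /addIr.
rewrite /level /= => xn; exists x0, m; split=> //.
by move: hy; rewrite hE /level /= (idxD x y) xn => ->.
Qed.

Lemma converges_fourier_term_base q x0 y (f : X -> R[i]) z :
  converges (fourier_term idx q x0 f z w) ->
  converges (fourier_term idx q y f z w).
Proof.
move=> /convergesP/(has_sumZ (cpow q (z * (idx x0 y w)%:~R))).
move/has_sum_converges; congr converges; apply/funext => x.
by rewrite /fourier_term -mulrA -cpowD -mulrDr -rmorphD -idxD.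
Qed.

Hypothesis idx_surj : forall y n, exists x, idx x y w = n.

Lemma fourier_slice_horospheres q x0 (f : X -> R[i]) z :
  converges (fourier_term idx q x0 f z w) ->
  [/\ forall n : int, radon_converges f (level idx x0 w n),
      converges (laplace_term q (fun n => radon f (level idx x0 w n)) z),
      fourier idx q x0 f z w =
        laplace q (fun n => radon f (level idx x0 w n)) z &
      forall h : set X, horosphere idx w h ->
        [/\ forall n : int, radon_converges f (hshift idx w n h),
            converges
              (laplace_term q (fun n => radon f (hshift idx w n h)) z),
            fourier_horo idx q f z w h =
              laplace q (fun n => radon f (hshift idx w n h)) z &
            h x0 -> fourier_horo idx q f z w h = fourier idx q x0 f z w]].
Proof.
move=> fC; have [radonC laplaceC fourierE] := fourier_slice fC.
split; [exact: radonC|exact: laplaceC|exact: fourierE|move=> h hh].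
(* The horosphere may miss [x0], so convergence is first moved to a base point lying on it. *)
have [y hy] : exists y, h y.
  by have [x1 [m ->]] := hh; have [y ym] := idx_surj x1 m; exists y.
have [radonCy laplaceCy _] :=
  fourier_slice (converges_fourier_term_base (y := y) fC).
have radonE x : h x -> (fun n => radon f (hshift idx w n h)) =
    (fun n => radon f (level idx x w n)).
  by move=> hx; apply/funext => n; rewrite (hshift_level n hh hx).
split=> [n|||hx0].
- rewrite (hshift_level n hh hy); exact: radonCy.
- rewrite (radonE y hy); exact: laplaceCy.
- exact: fourier_horoE.
- rewrite fourier_horoE (radonE x0 hx0); exact: esym fourierE.
Qed.

End CocycleIndex.

(** * Distances and geodesics in the tree *)

Section TreeDistance.
Context {q : nat} {T : homogeneous_tree q}.
Local Notation adj := (@adj q T).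

Lemma adj_sym : symmetric adj.
Proof. by case: T. Qed.

Lemma adj_irr : irreflexive adj.
Proof. by case: T. Qed.

Lemma adj_connected (u v : T) : exists2 p, path adj u p & last u p = v.
Proof. by case: T u v. Qed.

Lemma adj_acyclic (c : seq T) : (2 < size c)%N -> ~ ucycle adj c.
Proof. by case: T c. Qed.

Lemma adj_card (u : T) : ([set v | adj u v] #= `I_q.+1)%card.
Proof. by case: T u. Qed.

(** By connectedness some walk exists, so the minimum is attained and the default value in [dist] is
    never taken. *)
Lemma distP (u v : T) :
  walk_length u v (dist u v) /\
  forall m, walk_length u v m -> (dist u v <= m)%N.
Proof.
apply: (@xgetPex _ 0%N [set n | walk_length u v n /\
  forall m, walk_length u v m -> (n <= m)%N]).
have /ex_minnP[n /asboolP nw nmin] : exists n, `[< walk_length u v n >].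
  have [p pu pv] := adj_connected u v.
  by exists (size p); apply/asboolP; exists p.
by exists n; split=> // m mw; apply/nmin/asboolP.
Qed.

(** Removing loops from a shortest walk gives a simple path, whose length cannot fall below the
    distance. *)
Lemma dist_geodesic (u v : T) :
  exists p, [/\ path adj u p, uniq (u :: p), last u p = v & size p = dist u v].
Proof.
have [[p [pu pv ps]] dmin] := distP u v; move: pv ps.
have [p' pu' up' sub_p'p] := shortenP pu => pv ps; exists p'; split=> //.
apply/eqP; rewrite eqn_leq dmin ?andbT; last by exists p'.
rewrite -ps; case/andP: up' => _ up'; exact: uniq_leq_size.
Qed.

Lemma dist_walk (u : T) p : path adj u p -> (dist u (last u p) <= size p)%N.
Proof. by move=> pu; apply: (distP u _).2; exists p. Qed.

Lemma dist_triangle (v u t : T) : (dist u t <= dist u v + dist v t)%N.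
Proof.
have [p [pu _ pv <-]] := dist_geodesic u v.
have [p' [pv' _ pt <-]] := dist_geodesic v t.
by rewrite -size_cat -pt -pv -last_cat dist_walk // cat_path pu pv.
Qed.

Lemma dist_le_sym (u v : T) : (dist u v <= dist v u)%N.
Proof.
have [p [pv _ <- <-]] := dist_geodesic v u.
have lastE : last (last v p) (rev (belast v p)) = v.
  by case: p {pv} => //= a p; rewrite rev_cons last_rcons.
have := @dist_walk (last v p) (rev (belast v p)).
rewrite rev_path size_rev size_belast lastE; apply.
by rewrite (eq_path (e' := adj)) // => x y; rewrite adj_sym.
Qed.

Lemma dist_sym (u v : T) : dist u v = dist v u.
Proof. by apply/eqP; rewrite eqn_leq !dist_le_sym. Qed.

Lemma distxx (u : T) : dist u u = 0%N.
Proof. by apply/eqP; rewrite -leqn0 (@dist_walk u [::]). Qed.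

Lemma dist_eq0 (u v : T) : dist u v = 0%N -> u = v.
Proof. by have [p [_ _ <- <-]] := dist_geodesic u v; case: p. Qed.

Lemma dist_adj (u v : T) : adj u v -> (dist u v <= 1)%N.
Proof. by move=> uv; apply: (@dist_walk u [:: v]); rewrite /= uv. Qed.

Lemma dist_eq1 (u v : T) : dist u v = 1%N -> adj u v.
Proof.
have [p [pu _ <- <-]] := dist_geodesic u v.
by case: p pu => [|a []] //=; rewrite andbT.
Qed.

Lemma geodesic_mem (u : T) p c :
  path adj u p -> size p = dist u (last u p) -> c \in u :: p ->
  (dist u c + dist c (last u p) = size p)%N.
Proof.
move=> pu ps cp; have := dist_triangle c u (last u p); rewrite -ps.
case/splitPl: cp pu ps => p1 p2 <-; rewrite cat_path last_cat => /andP[pu1 pu2] _.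
have := dist_walk pu1; have := dist_walk pu2; rewrite size_cat.
by move: (dist _ _) (dist _ _) => a b; lia.
Qed.

(* If two geodesics to [z] issued from [y] and [y'] first meet at [z], then they
   close up, with the walk [y' -> s -> y], to a simple cycle; otherwise replace
   [z] by an earlier meeting point. *)
Lemma no_bigon (y y' : T) (s : seq T) :
  y != y' -> path adj y' (rcons s y) -> uniq s ->
  forall z, dist y z = dist y' z -> ~ {in s, forall u, (dist y z < dist u z)%N}.
Proof.
move=> yy' ys us z; have [n] := ubnP (dist y z).
elim: n z => // n IH z /ltnSE dn dE sP.
have [p [py up pz sp]] := dist_geodesic y z.
have [p' [py' up' pz' sp']] := dist_geodesic y' z.
have memp c : c \in y :: p -> (dist y c + dist c z = dist y z)%N.
  by move=> cp; rewrite -[in RHS]sp -(geodesic_mem py _ cp) pz.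
have memp' c : c \in y' :: p' -> (dist y' c + dist c z = dist y z)%N.
  by move=> cp; rewrite dE -[in RHS]sp' -(geodesic_mem py' _ cp) pz'.
have bp' c : c \in belast y' p' -> c \in y' :: p' /\ c != z.
  move: up'; rewrite lastI pz' rcons_uniq mem_rcons inE => /andP[zp' _] cp'.
  by rewrite cp' orbT; split=> //; apply: contraNneq zp' => <-.
have d0 : (0 < dist y z)%N.
  rewrite lt0n; apply: contra_neqN yy' => /eqP d0.
  by rewrite (dist_eq0 d0) (@dist_eq0 y' z) // -dE.
(* From [y] to [z] along [p], back to [y'] along [p'], then through [s] to [y]; [belast] avoids
   listing [z] twice. *)
pose c := (y :: p) ++ rev (belast y' p') ++ s.
apply: (@adj_acyclic c).
  by rewrite /c !size_cat size_rev size_belast sp' /= sp -dE; lia.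
rewrite /ucycle; apply/andP; split.
  rewrite /c /= rcons_cat cat_path py pz /= rcons_cat cat_path.
  rewrite -{1}pz' rev_path (eq_path (e' := adj)) ?py' /=; last first.
    by move=> u v; rewrite adj_sym.
  suff -> : last z (rev (belast y' p')) = y' by [].
  by case: (p') sp' => /= [|a p1 _]; [lia|rewrite rev_cons last_rcons].
rewrite cat_uniq up cat_uniq rev_uniq us andbT /=.
have ub : uniq (belast y' p') by move: up'; rewrite lastI rcons_uniq => /andP[].
have dsP u : u \in s -> u \notin y :: p /\ u \notin y' :: p'.
  move=> /sP us'; split; apply/negP; first by move=> /memp; lia.
  by move=> /memp'; lia.
rewrite ub /=; apply/andP; split; last first.
  apply/hasPn => u /dsP[_ up1] /=; rewrite mem_rev.
  by apply: contraNN up1 => /bp'[].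
apply/hasPn => u; rewrite mem_cat mem_rev => /orP[/bp'[up1 uz]|/dsP[]//].
apply/negP => up0; have e := memp _ up0; have e' := memp' _ up1.
have uz0 : (0 < dist u z)%N.
  by rewrite lt0n; apply: contra_neqN uz => /eqP/dist_eq0.
(* By [e] and [e'], [u] is equidistant from [y] and [y'], and nearer to them than [z]. The triangle
   inequality through [u] keeps [s] farther from [u] than [y] is. *)
apply: (IH u); [lia|lia|move=> x /sP xz].
have := dist_triangle u x z; lia.
Qed.

(** With equal distances, the edge itself would close a bigon, with [s] empty. *)
Lemma adj_dist_neq (x y z : T) : adj x y -> dist x z <> dist y z.
Proof.
move=> xy dE; apply: (@no_bigon x y [::] _ _ _ z dE) => //=.
  by apply: contraTneq xy => ->; rewrite adj_irr.
by rewrite andbT adj_sym.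
Qed.

(** Two distinct such neighbours would form a bigon closed through [s = [:: x]]. *)
Lemma parent_unique (x y y' z : T) : adj x y -> adj x y' ->
  (dist y z < dist x z)%N -> dist y z = dist y' z -> y = y'.
Proof.
move=> xy xy' yx dE; apply/eqP/negPn/negP => yy'.
apply: (@no_bigon y y' [:: x] yy' _ _ z dE) => //=.
  by rewrite xy adj_sym xy'.
by move=> u; rewrite inE => /eqP->.
Qed.

End TreeDistance.

(** * Busemann functions and the indices of vertices and edges *)

Section Busemann.
Context {q : nat} {T : homogeneous_tree q}.
Local Notation adj := (@adj q T).

Lemma nonincreasing_nat_eventually_cst (a : nat -> nat) :
  (forall n, (a n.+1 <= a n)%N) -> exists N, forall n, (N <= n)%N -> a n = a N.
Proof.
move=> aS; have aE : exists k, `[< exists n, a n = k >].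
  by exists (a 0%N); apply/asboolP; exists 0%N.
have [k /asboolP[N <-] kmin] := ex_minnP aE; exists N => n Nn.
have le_aN : (a n <= a N)%N.
  elim: n Nn => [|n IH]; first by rewrite leqn0 => /eqP->.
  rewrite leq_eqVlt => /orP[/eqP->//|/IH]; exact: leq_trans.
by apply/eqP; rewrite eqn_leq le_aN kmin //; apply/asboolP; exists n.
Qed.

Variables (w : tree_end T) (r : nat -> T).
Hypothesis r_geodesic : geodesic_ray r.
Hypothesis raysE : rays w = [set s | geodesic_ray s /\ cofinal r s].

Lemma busemann_ex (v : T) :
  exists b : int, exists N, forall n, (N <= n)%N ->
    (dist v (r n))%:Z = n%:Z + b.
Proof.
have lower n : (n <= dist v (r n) + dist v (r 0%N))%N.
  have := dist_triangle v (r 0%N) (r n).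
  by rewrite (r_geodesic (leq0n n)) (dist_sym _ v); lia.
have step n : (dist v (r n.+1) <= (dist v (r n)).+1)%N.
  have := dist_triangle (r n) v (r n.+1).
  by rewrite (r_geodesic (leqnSn n)); lia.
(* Adding the distance from [v] to [r 0] keeps the natural subtraction from truncating, by [lower];
   [step] makes the sequence nonincreasing. *)
have [N aN] := @nonincreasing_nat_eventually_cst
  (fun n => dist v (r n) + dist v (r 0%N) - n)%N
  (fun n => ltac:(have := step n; have := lower n; have := lower n.+1; lia)).
exists ((dist v (r N))%:Z - N%:Z), N => n /aN.
have := lower n; have := lower N; lia.
Qed.

(** The Busemann function of the end, normalised to vanish at [r 0]. *)
Definition busemann (v : T) : int := projT1 (cid (busemann_ex v)).

Lemma busemannP (v : T) : exists N, forall n, (N <= n)%N ->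
  (dist v (r n))%:Z = n%:Z + busemann v.
Proof. exact: projT2 (cid (busemann_ex v)). Qed.

Lemma busemann_ray (n : nat) : busemann (r n) = - n%:Z.
Proof.
have [N NP] := busemannP (r n).
have := NP _ (leq_maxl N n); rewrite (r_geodesic (leq_maxr N n)).
have := leq_maxr N n; lia.
Qed.

(** The ray [s] follows [r] up to a shift of parameter, which cancels in the difference. *)
Lemma dist_ray_diff (s : nat -> T) (u v : T) : rays w s ->
  exists N, forall n, (N <= n)%N ->
    (dist u (s n))%:Z - (dist v (s n))%:Z = busemann u - busemann v.
Proof.
rewrite raysE => -[_ [m [n rs]]].
have [N NP] := busemannP u; have [M MP] := busemannP v.
exists (n + N + M)%N => k kN.
have -> : k = (n + (k - n))%N by lia.
rewrite -rs NP; last by lia.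
by rewrite MP; lia.
Qed.

Lemma rays_r : rays w r.
Proof. by rewrite raysE; split=> //; exists 0%N, 0%N. Qed.

(** Follow a geodesic from [v0] to [r N], then [r]. Since [N] is past the stabilisation of the
    Busemann value at [v0], the distance to [v0] grows by one at each later step. *)
Lemma ray_from (v0 : T) : exists2 s, rays w s & s 0%N = v0.
Proof.
have [N NP] := busemannP v0.
have [p [pv0 _ pr ps]] := dist_geodesic v0 (r N).
pose d := dist v0 (r N).
pose s k := if (k < d)%N then nth v0 (v0 :: p) k else r (N + (k - d))%N.
have s0 : s 0%N = v0.
  rewrite /s; case: ltnP => //; rewrite leqn0 => /eqP d0.
  by rewrite d0 addn0 (dist_eq0 d0).
have sd : s d = r N by rewrite /s ltnn subnn addn0.
have s_nth k : (k <= d)%N -> s k = nth v0 (v0 :: p) k.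
  rewrite leq_eqVlt => /orP[/eqP->|kd]; last by rewrite /s kd.
  by rewrite sd -pr (last_nth v0) ps.
have s_step k : (dist (s k) (s k.+1) <= 1)%N.
  have [kd|dk] := ltnP k d.
    rewrite (s_nth k) ?(s_nth k.+1) ?(ltnW kd) //=.
    by apply: dist_adj; apply: (pathP v0 pv0); rewrite ps.
  rewrite /s !ltnNge dk (leqW dk) /= r_geodesic; lia.
have s_le m n : (m <= n)%N -> (dist (s m) (s n) <= n - m)%N.
  elim: n => [|n IH]; first by rewrite leqn0 => /eqP->; rewrite distxx.
  rewrite leq_eqVlt => /orP[/eqP->|mn]; first by rewrite distxx.
  have := dist_triangle (s n) (s m) (s n.+1); have := s_step n.
  by have := IH mn; lia.
have s_far n : (d <= n)%N -> dist v0 (s n) = n.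
  move=> dn; rewrite /s ltnNge dn /=; have := NP N (leqnn N).
  by have := NP (N + (n - d))%N (leq_addr _ _); rewrite -/d; lia.
exists s => //; rewrite raysE; split.
  (* The lower bound compares [m] and [n] with an index beyond [d], where the distance to [s 0] is
     exact: a shortcut between them would shorten that distance. *)
  move=> m n mn; apply/eqP; rewrite eqn_leq s_le //=.
  have := s_far _ (leq_maxr n d); have := s_le _ _ (leq0n m).
  have := s_le _ _ (leq_maxl n d); rewrite s0.
  have := dist_triangle (s n) (s m) (s (maxn n d)).
  have := dist_triangle (s m) v0 (s (maxn n d)).
  have := leq_maxl n d; lia.
exists N, d => k; rewrite /s ltnNge leq_addr /=; congr r; lia.
Qed.

Lemma vindexE (v v0 : T) : vindex v v0 w = busemann v0 - busemann v.
Proof.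
apply: xget_unique => /=.
  have [s ws s0] := ray_from v0; exists s => //.
  by have [N NP] := dist_ray_diff v0 v ws; exists N.
move=> k [s [ws _] [M _ MP]]; have [N NP] := dist_ray_diff v0 v ws.
by rewrite -(NP (maxn N M)) ?leq_maxl // -(MP (maxn N M)) //= leq_maxr.
Qed.

(** Seen from a far point of [r], adjacent vertices have distances differing by at most one, and
    never equal. *)
Lemma busemann_adj (x y : T) : adj x y ->
  busemann y = busemann x + 1 \/ busemann x = busemann y + 1.
Proof.
move=> xy; have [N NP] := busemannP x; have [M MP] := busemannP y.
have := NP _ (leq_maxl N M); have := MP _ (leq_maxr N M).
set z := r _; have := adj_dist_neq (z := z) xy; have := dist_adj xy.
have := dist_triangle x y z; have := dist_triangle y x z.
by rewrite (dist_sym y x); lia.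
Qed.

Lemma neighbours2 (x : T) : exists y y', [/\ adj x y, adj x y' & y != y'].
Proof.
(* If [q] were zero, the neighbours [r 0] and [r 2] of [r 1] would coincide, although their distance
   is two. *)
have q1 : (0 < q)%N.
  have /card_set_bijP[f [fI finj _]] := adj_card (r 1%N).
  have a0 : adj (r 1%N) (r 0%N) by rewrite adj_sym dist_eq1 // r_geodesic.
  have a2 : adj (r 1%N) (r 2%N) by rewrite dist_eq1 // r_geodesic.
  rewrite lt0n; apply/eqP => q0.
  have f0 : f (r 0%N) = 0%N by have := fI _ a0; rewrite /= q0; lia.
  have f2 : f (r 2%N) = 0%N by have := fI _ a2; rewrite /= q0; lia.
  have r02 : r 0%N = r 2%N.
    by apply: finj; rewrite ?inE // f0 f2.
  by have := r_geodesic (leq0n 2); rewrite -r02 distxx.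
have /card_set_bijP[f [_ _ fsurj]] := adj_card x.
have [y /= xy fy] := fsurj 0%N (ltn0Sn q).
have [y' /= xy' fy'] := fsurj 1%N q1.
by exists y, y'; split=> //; apply/eqP => yE; move: fy'; rewrite -yE fy.
Qed.

(** If two neighbours both had smaller value, they would be equidistant from a far point of [r] and
    closer to it than [x], against [parent_unique]. *)
Lemma child_ex (x : T) : exists2 y, adj x y & busemann y = busemann x + 1.
Proof.
have [y [y' [xy xy' yy']]] := neighbours2 x.
have [yx|xyE] := busemann_adj xy; first by exists y.
have [yx'|xyE'] := busemann_adj xy'; first by exists y'.
have [N NP] := busemannP x; have [M MP] := busemannP y.
have [L LP] := busemannP y'; pose n := (N + M + L)%N.
have {}NP : (dist x (r n))%:Z = n%:Z + busemann x by apply: NP; lia.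
have {}MP : (dist y (r n))%:Z = n%:Z + busemann y by apply: MP; lia.
have {}LP : (dist y' (r n))%:Z = n%:Z + busemann y' by apply: LP; lia.
case/eqP: yy'; apply: (parent_unique xy xy' (z := r n)); lia.
Qed.

(** Values up to zero occur along [r]; positive ones are reached by passing to children
    repeatedly. *)
Lemma busemann_surj (b : int) : exists x, busemann x = b.
Proof.
suff pos (k : nat) : exists x, busemann x = k.
  case: (intP b) => [|k|k]; [exact: pos 0%N|exact: pos|].
  by exists (r k.+1); rewrite busemann_ray.
elim: k => [|k [x xk]]; first by exists (r 0%N); rewrite busemann_ray.
by have [y _ yE] := child_ex x; exists y; rewrite yE xk; lia.
Qed.

Lemma closer_endpointE (u v : T) (e : edge T) :
  val e = [fset u; v]%fset -> busemann v = busemann u + 1 ->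
  closer_endpoint e w = [set u].
Proof.
move=> eE uv; apply/seteqP; split=> x /=; last first.
  move=> ->; split; first by rewrite eE !inE eqxx.
  exists r; first exact: rays_r.
  have [N NP] := dist_ray_diff v u rays_r; exists N => // n /= /NP dn y.
  rewrite eE !inE => /orP[/eqP->|/eqP-> _]; first by rewrite eqxx.
  by move: dn; lia.
rewrite /closer_endpoint /= eE => -[].
rewrite !inE => /orP[/eqP//|/eqP-> [s ws] [N _ NP]].
have [M MP] := dist_ray_diff v u ws.
have := MP _ (leq_maxr N M); have := NP _ (leq_maxl N M) u.
rewrite !inE eqxx /= => /(_ isT) H dE.
have /H : u != v by apply: contra_eq_neq uv => ->; lia.
by move: dE; lia.
Qed.

Lemma edge_endpoints (e : edge T) : exists u v,
  [/\ adj u v, val e = [fset u; v]%fset & busemann v = busemann u + 1].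
Proof.
have /asboolP[u [v [uv eE]]] := valP e.
have [vu|uvE] := busemann_adj uv; first by exists u, v.
by exists v, u; rewrite adj_sym eE fsetUC.
Qed.

(** The map [c] picks the closer endpoint, reducing the edge index to Busemann values. An edge from
    [u] to a child has closer endpoint [u], which gives surjectivity. *)
Lemma eindexE : exists c : edge T -> T,
  (forall e e0, eindex e e0 w = busemann (c e0) - busemann (c e)) /\
  (forall b : int, exists e, busemann (c e) = b).
Proof.
have closer1 (e : edge T) : exists u, closer_endpoint e w = [set u].
  have [u [v [_ eE uv]]] := edge_endpoints e.
  by exists u; exact: closer_endpointE eE uv.
have [c cE] := choice closer1; exists c; split=> [e e0|b].
  apply: xget_unique => /=.
    by exists (c e), (c e0); rewrite !cE vindexE.
  by move=> k [x [x0]]; rewrite !cE => -[-> ->]; rewrite vindexE.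
have [u ub] := busemann_surj b; have [v uv vE] := child_ex u.
pose isE (e : {fset T}) := `[< exists x y, adj x y /\ e = [fset x; y]%fset >].
have eP : isE [fset u; v]%fset by apply/asboolP; exists u, v.
pose e : edge T := exist isE [fset u; v]%fset eP; exists e.
have := @closer_endpointE u v e erefl vE.
by rewrite cE => /seteqP[/(_ _ erefl) /= ->].
Qed.

End Busemann.

(** * Application to vertices and to edges *)

Lemma tree_end_ray {q : nat} {T : homogeneous_tree q} (w : tree_end T) :
  exists2 r, geodesic_ray r & rays w = [set s | geodesic_ray s /\ cofinal r s].
Proof. by case: w. Qed.

Theorem proposition2p9p1 (R : realType) (q : nat) (T : homogeneous_tree q)
    (v0 : T) (e0 : edge T) :
  (forall (f : T -> R[i]) (z : R[i]) (w : tree_end T),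
     converges (fourier_term (@vindex q T) q v0 f z w) ->
     [/\ forall n : int, radon_converges f (level (@vindex q T) v0 w n),
         converges
           (laplace_term q (fun n => radon f (level (@vindex q T) v0 w n)) z),
         fourier (@vindex q T) q v0 f z w =
           laplace q (fun n => radon f (level (@vindex q T) v0 w n)) z &
         forall h : set T, horosphere (@vindex q T) w h ->
           [/\ forall n : int,
                 radon_converges f (hshift (@vindex q T) w n h),
               converges
                 (laplace_term q
                    (fun n => radon f (hshift (@vindex q T) w n h)) z),
               fourier_horo (@vindex q T) q f z w h =
                 laplace q (fun n => radon f (hshift (@vindex q T) w n h)) z &
               h v0 -> fourier_horo (@vindex q T) q f z w h =
                       fourier (@vindex q T) q v0 f z w]])
  /\
  (forall (f : edge T -> R[i]) (z : R[i]) (w : tree_end T),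
     converges (fourier_term (@eindex q T) q e0 f z w) ->
     [/\ forall n : int, radon_converges f (level (@eindex q T) e0 w n),
         converges
           (laplace_term q (fun n => radon f (level (@eindex q T) e0 w n)) z),
         fourier (@eindex q T) q e0 f z w =
           laplace q (fun n => radon f (level (@eindex q T) e0 w n)) z &
         forall h : set (edge T), horosphere (@eindex q T) w h ->
           [/\ forall n : int,
                 radon_converges f (hshift (@eindex q T) w n h),
               converges
                 (laplace_term q
                    (fun n => radon f (hshift (@eindex q T) w n h)) z),
               fourier_horo (@eindex q T) q f z w h =
                 laplace q (fun n => radon f (hshift (@eindex q T) w n h)) z &
               h e0 -> fourier_horo (@eindex q T) q f z w h =
                       fourier (@eindex q T) q e0 f z w]]).
Proof.
split=> f z w; have [r r_geodesic raysE] := tree_end_ray w.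
  apply: fourier_slice_horospheres => [x y t|y n].
    by rewrite !(vindexE r_geodesic raysE); ring.
  (* The index of [x] relative to [y] is the value at [y] minus that at [x], hence the target
     value. *)
  have [x xE] := busemann_surj r_geodesic (busemann r_geodesic y - n).
  by exists x; rewrite (vindexE r_geodesic raysE) xE; ring.
have [c [cE c_surj]] := eindexE r_geodesic raysE.
apply: fourier_slice_horospheres => [x y t|y n]; first by rewrite !cE; ring.
have [x xE] := c_surj (busemann r_geodesic (c y) - n).
by exists x; rewrite cE xE; ring.
Qed.
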